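(* Let $(\mathcal{X},\rho,\nu)$ be a bounded length space with a doubling metric $\rho$ and finite Borel measure $\nu$. Let $\eta\in\mathcal{F}_0$, and let $\mathbb{X}=(X_n)_{n\ge0}$ be a $\sigma$-smoothed process with respect to $\nu$ for some $\sigma>0$. Suppose the boundary $\partial_\eta\mathcal{X}$ has box-counting dimension $\mathfrak{b}>1$ and Minkowski content $\mathfrak{m}$. Then for any $c_1,c_2,p>0$ there exist constants $C_0,C_1>0$ such that, for any nearest neighbor process $(\tilde X_n)_{n\ge1}$, with probability at least $1-p$ the following holds simultaneously for all $N\in\mathbb{N}$: \[\sum_{n=1}^N\mathbb{1}\{\eta(X_n)\ne\eta(\tilde X_n)\}\le C_0+C_1\left(\frac{(\mathfrak{m}+c_2)N}{\sigma}\right)^{(\mathfrak{b}+c_1)/(\mathfrak{b}+1)}.\]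
   Context: A metric space is a length space if $\rho(x,x')=\inf_\gamma\ell(\gamma)$ over continuous paths $\gamma:[0,1]\to\mathcal{X}$ from $x$ to $x'$, with $\ell(\gamma)$ the length of $\gamma$. A metric is doubling if for some $d$ every open ball $B(x,r)$ can be covered by $2^d$ balls of radius $r/2$. $\mathrm{margin}_\eta(x)=\inf\{\rho(x,x'):\eta(x')\ne\eta(x)\}$, $\partial_\eta\mathcal{X}=\{x:\mathrm{margin}_\eta(x)=0\}$, and $\mathcal{F}_0$ is the set of measurable $\eta$ with $\nu(\partial_\eta\mathcal{X})=0$. $\mathbb{X}$ is $\sigma$-smoothed if $\Pr(X_n\in A\mid X_0,\dots,X_{n-1})\le\sigma^{-1}\nu(A)$ for all $n$ and all measurable $A$. A nearest neighbor process is any $(\tilde X_n)_{n\ge1}$ with $\tilde X_n\in\arg\min_{x\in\{X_0,\dots,X_{n-1}\}}\rho(X_n,x)$. For $A\subset\mathcal{X}$, $\mathcal{N}_r(A)$ is the minimal number of open balls of radius $r$ covering $A$; the (upper) box-counting dimension is $\mathfrak{b}(A)=\limsup_{r\to0}\frac{\log\mathcal{N}_r(A)}{\log(1/r)}$. The $r$-expansion is $A^r=\bigcup_{x\in A}B(x,r)$, and the (upper) Minkowski content is $\mathfrak{m}(A)=\limsup_{r\to0}\frac{\nu(A^r)-\nu(A)}{r}$. *)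

(* Defs.v *)
From HB Require Import structures.
From mathcomp Require Import all_boot all_order all_algebra.
From mathcomp Require Import all_classical all_reals all_analysis.
Set Implicit Arguments. Unset Strict Implicit. Unset Printing Implicit Defensive.
Import Order.TTheory GRing.Theory Num.Theory.
Import numFieldNormedType.Exports.
Local Open Scope classical_set_scope.
Local Open Scope ring_scope.

Section Defs.
Variables (R : realType) (T : choiceType) (rho : T -> T -> R).

Definition is_metric : Prop :=
  [/\ (forall x y, 0 <= rho x y),
      (forall x y, rho x y = 0 <-> x = y),
      (forall x y, rho x y = rho y x) &
      (forall x y z, rho x z <= rho x y + rho y z)].

Definition oball (x : T) (r : R) : set T := [set y | rho x y < r].

Definition rho_open (A : set T) : Prop :=
  forall x, A x -> exists2 r : R, 0 < r & oball x r `<=` A.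

Definition metric_bounded : Prop := exists M : R, forall x y, rho x y <= M.

Definition doubling : Prop :=
  exists dd : nat, forall (x : T) (r : R),
    exists s : seq T, (size s <= 2 ^ dd)%N /\
      oball x r `<=` \bigcup_(c in [set c | c \in s]) oball c (r / 2).

Definition is_path (x x' : T) (gamma : R -> T) : Prop :=
  [/\ gamma 0 = x, gamma 1 = x' &
    forall t, 0 <= t <= 1 -> forall e : R, 0 < e -> exists2 delta : R, 0 < delta &
      forall s, 0 <= s <= 1 -> `|s - t| < delta -> rho (gamma s) (gamma t) < e].

Definition path_length (gamma : R -> T) : \bar R :=
  ereal_sup [set v | exists (k : nat) (t : nat -> R),
     [/\ t 0%N = 0, t k = 1, (forall i, (i < k)%N -> t i <= t i.+1) &
          v = (\sum_(i < k) rho (gamma (t i)) (gamma (t i.+1)))%:E]].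

Definition length_space : Prop :=
  forall x x', ((rho x x')%:E = ereal_inf [set path_length g | g in is_path x x'])%E.

Definition cover_num (A : set T) (r : R) : \bar R :=
  ereal_inf [set (n%:R)%:E | n in [set n : nat | exists s : seq T, size s = n /\
                 A `<=` \bigcup_(c in [set c | c \in s]) oball c r]].

Definition box_ratio (A : set T) (r : R) : \bar R :=
  match cover_num A r with
  | v%:E => if 0 < v then (ln v / ln r^-1)%:E else -oo%E
  | +oo%E => +oo%E
  | -oo%E => -oo%E
  end.

Definition box_dim (A : set T) : \bar R := limf_esup (box_ratio A) (0%R^'+).

Definition expansion (A : set T) (r : R) : set T := \bigcup_(x in A) oball x r.

End Defs.

Section MeasDefs.
Variables (R : realType) (dT : measure_display) (T : measurableType dT).
Variable (rho : T -> T -> R).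

Definition borel_wrt : Prop := @measurable dT T = <<s rho_open rho >>.

Definition minkowski_content (nu : {measure set T -> \bar R}) (A : set T) : \bar R :=
  limf_esup (fun r : R => ((nu (expansion rho A r) - nu A) * (r^-1)%:E)%E) (0%R^'+).

Variables (dY : measure_display) (Y : measurableType dY) (eta : T -> Y).

Definition margin (x : T) : \bar R :=
  ereal_inf [set (rho x x')%:E | x' in [set x' | eta x' <> eta x]].

Definition eta_boundary : set T := [set x | margin x = 0%E].

Definition in_F0 (nu : {measure set T -> \bar R}) : Prop :=
  measurable_fun setT eta /\ nu eta_boundary = 0%E.

Variables (dO : measure_display) (Omega : measurableType dO) (P : probability Omega R).

Definition past_gen (X : nat -> Omega -> T) (n : nat) : set (set Omega) :=
  [set E | exists i C, [/\ (i < n)%N, measurable C & E = X i @^-1` C]].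

(* sigma-smoothed: Pr(X_n in A | X_0..X_{n-1}) <= sigma^-1 nu(A) a.s., written via the
   defining property of conditional probability:
   P({X_n in A} \cap B) <= sigma^-1 nu(A) P(B) for every B in sigma(X_0,...,X_{n-1}). *)
Definition smoothed (nu : {measure set T -> \bar R}) (sigma : R) (X : nat -> Omega -> T) : Prop :=
  forall n (A : set T), measurable A -> forall B : set Omega, <<s past_gen X n >> B ->
    (P (X n @^-1` A `&` B) <= (sigma^-1)%:E * nu A * P B)%E.

Definition nn_process (X Xt : nat -> Omega -> T) : Prop :=
  forall n w, (0 < n)%N ->
    (exists2 i, (i < n)%N & Xt n w = X i w) /\
    (forall i, (i < n)%N -> rho (X n w) (Xt n w) <= rho (X n w) (X i w)).

End MeasDefs.

(* Main.v *)
(* In a length space every mistake straddles the boundary, so a mistake at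
   distance at least s from the boundary is at distance at least s from all
   earlier points.  Hence the mistakes farther than r from the boundary are
   controlled, scale by scale, by covering numbers of the boundary: at most
   O(r^-(b+c1)) of them ever occur.  The visits to the r-expansion of the
   boundary up to time N have expectation O(r N / sigma) by smoothness and the
   Minkowski content.  Taking r = N^(-1/(b+1)) at the dyadic times N = 2^k
   balances both contributions, up to the slack c1. *)
Require Import Defs.
From HB Require Import structures.
From mathcomp Require Import all_boot all_order all_algebra.
From mathcomp Require Import all_classical all_reals all_analysis.
From mathcomp Require Import measurable_realfun.
From mathcomp Require Import ring lra.
Import Order.TTheory GRing.Theory Num.Theory.
Import numFieldNormedType.Exports.
Local Open Scope classical_set_scope.
Local Open Scope ring_scope.

(** * Boundary points between two labels *)

(** Follow a path from [x] to [x'] of length below [rho x x' + e] and stop at the supremum [t0] of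
    the times whose label is [eta x]. Both labels other than [eta (g t0)] and points arbitrarily
    close to [g t0] meet there, so its margin vanishes, and the leg from [x] to [g t0] is no longer
    than the path. *)
Lemma boundary_between (R : realType) (dT : measure_display)
    (T : measurableType dT) (rho : T -> T -> R) (dY : measure_display)
    (Y : measurableType dY) (eta : T -> Y) (x x' : T) (e : R) :
  is_metric rho -> length_space rho -> eta x <> eta x' -> 0 < e ->
  exists2 z, eta_boundary rho eta z & rho x z < rho x x' + e.
Proof.
move=> [rho_ge0 _ rhoC _] rho_len nxx' e0.
have : (ereal_inf [set path_length rho g | g in is_path rho x x'] <
    (rho x x' + e)%:E)%E by rewrite -rho_len lte_fin ltrDl.
move=> /ereal_inf_lt[_ [g [g0 g1 gc] <-] gl].
pose A := [set t : R | 0 <= t <= 1 /\ eta (g t) = eta x].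
have A0 : A 0 by split; rewrite ?lexx ?ler01// g0.
have supA : has_sup A by split; [exists 0|exists 1 => t [/andP[]]].
pose t0 := sup A.
have t0_ge0 : 0 <= t0 by apply: sup_upper_bound.
have t0_le1 : t0 <= 1.
  by apply: ge_sup; [exists 0|move=> t [/andP[]]].
have t01 : 0 <= t0 <= 1 by rewrite t0_ge0.
exists (g t0).
  rewrite /eta_boundary /= /margin; apply/eqP; rewrite eq_le; apply/andP; split; last first.
    by apply: le_ereal_inf_tmp => _ [y _ <-]; rewrite lee_fin.
  apply/lee_addgt0Pr => d d0; rewrite add0e.
    suff [y ny yd] : exists2 y, eta y <> eta (g t0) & rho (g t0) y < d.
      by apply: ge_ereal_inf; exists (rho (g t0) y)%:E; [exists y|rewrite lee_fin ltW].
    have [dl dl0 gt0] := gc _ t01 _ d0.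
    (* If [g t0] carries the label of [x], every later time carries another one; otherwise times
       just before [t0] carry the label of [x]. *)
    have [t0A|t0A] := pselect (eta (g t0) = eta x).
      have t0_lt1 : t0 < 1.
        rewrite lt_neqAle t0_le1 andbT; apply/eqP => t1.
        by apply: nxx'; rewrite -t0A t1 g1.
      pose t := Num.min 1 (t0 + dl / 2).
      have t0t : t0 < t by rewrite lt_min t0_lt1 ltrDl divr_gt0.
      have tle : 0 <= t <= 1 by rewrite (le_trans t0_ge0 (ltW t0t))/= ge_min lexx.
      have tdl : `|t - t0| < dl.
        rewrite ger0_norm ?subr_ge0 1?ltW//.
        have : t <= t0 + dl / 2 by rewrite ge_min lexx orbT.
        by lra.
      exists (g t); last by rewrite rhoC gt0.
      rewrite t0A => gtx.
      suff : t <= t0 by rewrite leNgt t0t.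
      by apply: sup_upper_bound => //; split.
    have [t [tle gtx] t0t] := sup_adherent dl0 supA.
    exists (g t); first by rewrite gtx => /esym.
    rewrite rhoC gt0// ler0_norm; first by rewrite opprB ltrBlDr addrC -ltrBlDr.
    by rewrite subr_le0; apply: sup_upper_bound.
rewrite -lte_fin; apply: le_lt_trans gl.
apply: ereal_sup_ge.
(* The subdivision [0, t0, 1] bounds the length of the path from below. *)
exists (rho x (g t0) + rho (g t0) x')%:E; last by rewrite lee_fin lerDl.
exists 2%N, (fun i => if i is 0%N then 0 else if i is 1%N then t0 else 1).
split => //; first by case=> [|[|]].
by rewrite !big_ord_recl big_ord0 addr0 /= g0 g1.
Qed.

(** * Covers and separated families *)

Lemma halve_cover (R : realType) (T : choiceType) (rho : T -> T -> R) (dd : nat) (r : R) :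
  (forall x : T, exists s : seq T, (size s <= 2 ^ dd)%N /\
      oball rho x r `<=` \bigcup_(c in [set c | c \in s]) oball rho c (r / 2)) ->
  forall (A : set T) (C : seq T),
  A `<=` \bigcup_(c in [set c | c \in C]) oball rho c r ->
  exists2 C', (size C' <= size C * 2 ^ dd)%N &
    A `<=` \bigcup_(c in [set c | c \in C']) oball rho c (r / 2).
Proof.
move=> /choice[f hf] A C AC; exists (flatten [seq f c | c <- C]).
  elim: C {A AC} => //= c C IH; rewrite size_cat mulSn leq_add//.
  by have [] := hf c.
move=> y /AC[c /= cC /(proj2 (hf c))[c' /= c'c yc']].
by exists c' => //=; apply/flattenP; exists (f c) => //; exact: map_f.
Qed.

(** Pigeonhole: two points at distance at least [s] cannot share a ball of radius [s / 2], so
    assigning to each index a center of its ball is injective. *)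
Lemma separated_size (R : realType) (T : choiceType) (rho : T -> T -> R)
    (x : nat -> T) (s : R) (I : seq nat) (C : seq T) :
  is_metric rho -> uniq I ->
  (forall i j, i \in I -> j \in I -> (i < j)%N -> s <= rho (x j) (x i)) ->
  (forall i, i \in I -> exists2 c, c \in C & rho c (x i) < s / 2) ->
  (size I <= size C)%N.
Proof.
move=> [rho_ge0 _ rhoC rhoD] uI sepI IC.
have /choice[f hf] i : exists c, i \in I -> c \in C /\ rho c (x i) < s / 2.
  have [/IC[c cC xc]|] := boolP (i \in I); first by exists c.
  by exists (x i).
have H i j : i \in I -> j \in I -> (i < j)%N -> f i = f j -> False.
  move=> iI jI ij fij; have := sepI _ _ iI jI ij.
  have [_ hi] := hf _ iI; have [_ hj] := hf _ jI.
  have := rhoD (x j) (f i) (x i); rewrite (rhoC _ (f i)) {1}fij.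
  by lra.
rewrite -(size_map f); apply: uniq_leq_size.
  rewrite map_inj_in_uniq// => i j iI jI fij.
  by have [ij|ij|//] := ltngtP i j; case: (H _ _ _ _ ij).
by move=> _ /mapP[i /hf[? _] ->].
Qed.

(** * Boundary covers at every scale and the count of far points *)

Lemma limf_esup_right_lt (R : realType) (f : R -> \bar R) (c : \bar R) :
  (limf_esup f 0%R^'+ < c)%E ->
  exists2 r0, 0 < r0 & forall r, 0 < r -> r < r0 -> (f r < c)%E.
Proof.
rewrite limf_esupE => /ereal_inf_lt[_ [V V0 <-] Vc].
have /= [r0 r00 Hr] := V0.
exists r0 => // r rgt0 rr0; apply: le_lt_trans Vc; apply: ereal_sup_ubound.
exists r => //; apply: Hr => //=.
by rewrite sub0r normrN gtr0_norm.
Qed.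

(** The dimension controls small radii only. From a fixed radius [s0] up to [M], the cover at [s0]
    is reused, and its size is absorbed in the constant because [M ^ beta * s ^ (- beta)] is at
    least 1. *)
Lemma box_dim_cover (R : realType) (T : choiceType) (rho : T -> T -> R)
    (A : set T) (b beta M : R) :
  box_dim rho A = b%:E -> b < beta -> 0 < beta -> 0 < M ->
  exists2 K, 0 < K & forall s, 0 < s -> s <= M ->
    exists2 C : seq T, (size C)%:R <= K * s `^ (- beta) &
      A `<=` \bigcup_(c in [set c | c \in C]) oball rho c s.
Proof.
move=> bA bbeta beta0 M0.
have /limf_esup_right_lt[r0 r00 hr] : (box_dim rho A < beta%:E)%E.
  by rewrite bA lte_fin.
have cover_small r : 0 < r -> r < Num.min r0 1 ->
    exists2 C : seq T, (size C)%:R <= 2 * r `^ (- beta) &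
      A `<=` \bigcup_(c in [set c | c \in C]) oball rho c r.
  move=> rgt0; rewrite lt_min => /andP[rr0 r1].
  have rbeta1 : 1 <= r `^ (- beta).
    rewrite -[leLHS](powRr0 r); apply: ger_powR; first by rewrite rgt0 ltW.
    by rewrite oppr_le0 ltW.
  have /ereal_inf_lt[_ [n [C [<- AC] <-]]] :
      (cover_num rho A r < (r `^ (- beta) + 1)%:E)%E.
    have := hr r rgt0 rr0; rewrite /box_ratio.
    case: (cover_num rho A r) => [v||_] //; last exact: ltNyr.
    (* For [v <= 0] the ratio is minus infinity and the added 1 settles the bound; this 1 is later
       absorbed in the factor 2, since [r < 1]. *)
    have [v0 |v0 _] := ltP 0 v; last first.
      by rewrite lte_fin (le_lt_trans v0)// ltr_wpDl// powR_ge0.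
    have lnr : 0 < ln r^-1 by rewrite ln_gt0// invf_gt1.
    rewrite !lte_fin ltr_pdivrMr// lnV ?posrE// mulrN -mulNr => lnv.
    rewrite ltr_wpDr//.
    by rewrite /powR gt_eqF// -(lnK v0) ltr_expR.
  rewrite lte_fin => sC; exists C => //; lra.
pose s0 := Num.min r0 1 / 2.
have min0 : 0 < Num.min r0 1 by rewrite lt_min r00 ltr01.
have s00 : 0 < s0 by rewrite divr_gt0.
have s0min : s0 < Num.min r0 1 by rewrite /s0; lra.
exists (2 + 2 * s0 `^ (- beta) * M `^ beta).
  by rewrite ltr_pwDl// !mulr_ge0 ?powR_ge0.
move=> s sgt0 sM.
have [ss0|s0s] := ltP s s0.
  have [C sC AC] := cover_small _ sgt0 (lt_trans ss0 s0min).
  exists C => //; apply: le_trans sC _; apply: ler_wpM2r; first exact: powR_ge0.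
  by rewrite lerDl !mulr_ge0 ?powR_ge0.
have [C sC AC] := cover_small _ s00 s0min.
exists C; last first.
  by move=> y /AC[c cC]; exists c => //; apply: lt_le_trans s0s.
apply: le_trans sC _; rewrite [leRHS]mulrDl -[leLHS]add0r.
apply: lerD; first by rewrite mulr_ge0 ?powR_ge0.
have Ms : 1 <= M `^ beta * s `^ (- beta).
  rewrite powRN ler_pdivlMr ?powR_gt0// mul1r.
  by apply: ge0_ler_powR => //; rewrite ?nnegrE ltW.
rewrite -[leRHS]mulrA; apply: (@ler_peMr _ _ _ _ Ms).
by rewrite mulr_ge0 ?powR_ge0.
Qed.

(* Dyadic decomposition of the distance to [A]: at each scale the points of [I]
   are separated, so a covering of [A] bounds their number, and the bounds form
   a geometric series. *)
Lemma far_size (R : realType) (T : choiceType) (rho : T -> T -> R) (dd : nat)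
    (A : set T) (K M beta : R) (x : nat -> T) :
  is_metric rho -> (forall y z, rho y z <= M) ->
  (forall (y : T) (r : R), exists s : seq T, (size s <= 2 ^ dd)%N /\
      oball rho y r `<=` \bigcup_(c in [set c | c \in s]) oball rho c (r / 2)) ->
  0 <= K -> 1 <= beta ->
  (forall s, 0 < s -> s <= M -> exists2 C : seq T,
     (size C)%:R <= K * s `^ (- beta) &
     A `<=` \bigcup_(c in [set c | c \in C]) oball rho c s) ->
  A !=set0 ->
  forall (I : seq nat) (r : R), uniq I ->
  (forall i j, i \in I -> j \in I -> (i < j)%N -> forall s,
     (forall z, A z -> s <= rho (x j) z) -> s <= rho (x j) (x i)) ->
  0 < r -> (forall i, i \in I -> forall z, A z -> r <= rho (x i) z) ->
  (size I)%:R <= 2 * (2 ^ dd * 2 ^ dd * 2 ^ dd)%:R * K * r `^ (- beta).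
Proof.
move=> mrho rhoM doub K0 beta1 covA [z0 Az0] I r uI sepI rgt0 farI.
set L := (2 ^ dd * 2 ^ dd * 2 ^ dd)%N.
have pos s : 0 <= L%:R * K * s `^ (- beta) by rewrite !mulr_ge0 ?powR_ge0.
have [j Mj] : exists j : nat, M < 2 ^+ j * r.
  exists (Num.bound (M / r)); rewrite -ltr_pdivrMr//.
  exact: upper_nthrootP.
(* Induction on the number of doublings that take [r] beyond [M]. When [r] itself exceeds [M], no
   point is that far from [A], so [I] is empty. *)
elim: j r I uI sepI rgt0 farI Mj => [|j IH] r I uI sepI rgt0 farI Mj.
  case: I {uI sepI} farI => [_|i I farI]; first by rewrite -!mulrA mulr_ge0// mulrA pos.
  have := farI i (mem_head _ _) _ Az0.
  by rewrite leNgt (le_lt_trans (rhoM _ _))// -[r]mul1r.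
pose near i := `[< exists2 z, A z & rho (x i) z < 2 * r >].
have far_part : (size [seq i <- I | ~~ near i])%:R <= L%:R * K * r `^ (- beta).
  have /(IH (2 * r)) H : uniq [seq i <- I | ~~ near i] by rewrite filter_uniq.
  apply: le_trans (H _ _ _ _) _ => {H}.
  - move=> i k; rewrite !mem_filter => /andP[_ iI] /andP[_ kI].
    exact: sepI.
  - by rewrite mulr_gt0.
  - move=> i; rewrite mem_filter => /andP[/asboolPn ni iI] z Az.
    by rewrite leNgt; apply/negP => zr; apply: ni; exists z.
  - by rewrite mulrA -exprSr.
  (* As [beta >= 1], passing from [r] to [2 * r] at least halves the bound: the factor 2 of the
     induction hypothesis cancels. *)
  rewrite powRM ?(ltW rgt0)// -!mulrA mulrCA ler_wpM2l// mulrCA ler_wpM2l//.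
  rewrite mulrA ler_piMl ?powR_ge0// powRN ler_pdivrMr ?powR_gt0// mul1r.
  by rewrite -[leLHS]powRr1// ler_powR// ler1n.
have near_part : (size [seq i <- I | near i])%:R <= L%:R * K * r `^ (- beta).
  have [rM|Mr] := leP r M; last first.
    suff -> : [seq i <- I | near i] = [::] by rewrite pos.
    case: I farI {far_part uI sepI} => [//|i I farI].
    have := farI i (mem_head _ _) _ Az0.
    by rewrite leNgt (le_lt_trans (rhoM _ _)).
  have [C sC AC] := covA _ rgt0 rM.
  pose B := [set y | exists2 z, A z & rho y z < 2 * r].
  have BC : B `<=` \bigcup_(c in [set c | c \in C]) oball rho c (3 * r).
    move=> y [z /AC[c cC cz] yz]; exists c => //.
    have [_ _ rhoC rhoD] := mrho.
    by move: cz yz (rhoD c z y); rewrite /oball/= (rhoC y z); lra.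
  (* Three halvings bring the radius [3 * r] to [3 * r / 8], below the [r / 2] that separation by
     [r] requires; hence the three factors [2 ^ dd]. *)
  have [C1 sC1 {}BC] := halve_cover _ _ _ _ _ (fun y => doub y _) _ _ BC.
  have [C2 sC2 {}BC] := halve_cover _ _ _ _ _ (fun y => doub y _) _ _ BC.
  have [C3 sC3 {}BC] := halve_cover _ _ _ _ _ (fun y => doub y _) _ _ BC.
  have : (size [seq i <- I | near i] <= size C3)%N.
    apply: (separated_size _ _ _ _ r _ _ mrho) => [|i k|i].
    - by rewrite filter_uniq.
    - rewrite !mem_filter => /andP[_ iI] /andP[_ kI] ik.
      by apply: (sepI i k) => // z; apply: farI.
    - rewrite mem_filter => /andP[/asboolP iB _].
      have [c cC ci] := BC _ iB; exists c => //.
      by move: ci; rewrite /oball/=; lra.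
  rewrite -(ler_nat R) => /le_trans; apply.
  have : (size C3 <= L * size C)%N.
    rewrite mulnC /L !mulnA (leq_trans sC3)// leq_mul//.
    by rewrite (leq_trans sC2)// leq_mul.
  rewrite -(ler_nat R) natrM => /le_trans; apply.
  by rewrite -mulrA ler_wpM2l.
have -> : size I = (size [seq i <- I | near i] + size [seq i <- I | ~~ near i])%N.
  by rewrite !size_filter count_predC.
by rewrite natrD; lra.
Qed.

(** * Measure of expansions *)

Lemma measurable_expansion (R : realType) (dT : measure_display)
    (T : measurableType dT) (rho : T -> T -> R) (A : set T) (r : R) :
  is_metric rho -> borel_wrt rho -> measurable (expansion rho A r).
Proof.
move=> [_ _ _ rhoD] borel; rewrite borel; apply: sub_sigma_algebra.
move=> y [z Az zy]; exists (r - rho z y); first by rewrite subr_gt0.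
move=> u yu; exists z => //; rewrite /oball/= (le_lt_trans (rhoD _ y _))//.
by rewrite addrC -ltrBrDr.
Qed.

Lemma minkowski_content_ge0 (R : realType) (dT : measure_display)
    (T : measurableType dT) (rho : T -> T -> R) (nu : {measure set T -> \bar R})
    (A : set T) :
  is_metric rho -> nu A = 0%E -> (0 <= minkowski_content rho nu A)%E.
Proof.
move=> [rho_ge0 _ _ _] nuA; apply: limf_esup_ge0 => [|r].
  exact: filter_not_empty.
rewrite nuA sube0; have [r0|r0] := ltP 0 r.
  by rewrite mule_ge0// lee_fin invr_ge0 ltW.
suff -> : expansion rho A r = set0 by rewrite measure0 mul0e.
rewrite -subset0 => y [z _]; rewrite /oball/= => /lt_le_trans /(_ r0).
by rewrite ltNge rho_ge0.
Qed.

(** The content gives slope [m + 1] for [r] below some [r0]; from [r0] on, the total mass is at most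
    [nu setT / r0] times [r]. *)
Lemma minkowski_linear (R : realType) (dT : measure_display)
    (T : measurableType dT) (rho : T -> T -> R) (nu : {measure set T -> \bar R})
    (A : set T) (m : R) :
  is_metric rho -> borel_wrt rho -> (nu setT < +oo)%E -> nu A = 0%E ->
  minkowski_content rho nu A = m%:E ->
  exists2 K, 0 <= K &
    forall r, 0 < r -> (nu (expansion rho A r) <= (K * r)%:E)%E.
Proof.
move=> mrho borel nufin nuA cA.
have m0 : 0 <= m.
  by rewrite -lee_fin -cA; apply: minkowski_content_ge0.
have /limf_esup_right_lt[r0 r00 hr] :
    (minkowski_content rho nu A < (m + 1)%:E)%E.
  by rewrite cA lte_fin ltrDl.
have nuTE : nu setT = (fine (nu setT))%:E.
  by rewrite fineK// ge0_fin_numE.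
have v0 : 0 <= fine (nu setT) by rewrite fine_ge0.
exists (m + 1 + fine (nu setT) / r0).
  by rewrite !addr_ge0// divr_ge0// ltW.
move=> r rgt0; have [rr0|r0r] := ltP r r0.
  have := ltW (hr r rgt0 rr0); rewrite nuA sube0 lee_pdivrMr// -EFinM.
  move=> /le_trans; apply; rewrite lee_fin ler_wpM2r ?(ltW rgt0)//.
  by rewrite lerDl divr_ge0// ltW.
apply: (@le_trans _ _ (nu setT)).
  by apply: le_measure; rewrite ?inE//; exact: measurable_expansion.
rewrite nuTE lee_fin mulrDl -[leLHS]add0r lerD//.
  by rewrite mulr_ge0// ?ltW//; lra.
by rewrite mulrAC ler_pdivlMr// ler_wpM2l.
Qed.

(** * First-moment and union bounds *)

Lemma markov_count (R : realType) (d : measure_display) (Omega : measurableType d)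
    (P : probability Omega R) (A : nat -> set Omega) (I : seq nat) (q lam : R) :
  (forall n, measurable (A n)) -> (forall n, (P (A n) <= q%:E)%E) -> 0 < lam ->
  let bad := [set w | lam <= \sum_(n <- I) \1_(A n) w] in
  measurable bad /\ (P bad <= ((size I)%:R * q / lam)%:E)%E.
Proof.
move=> mA PA lam0 bad; pose g w : \bar R := (\sum_(n <- I) (\1_(A n) w)%:E)%E.
have m1 n : measurable_fun setT (EFin \o (\1_(A n) : Omega -> R)).
  exact/measurable_EFinP/measurable_indic.
have mg : measurable_fun setT g by exact: emeasurable_sum.
have g0 w : (0 <= g w)%E by apply: sume_ge0 => n _; rewrite lee_fin.
have badE : bad = setT `&` [set w | lam%:E <= `|g w|]%E.
  by rewrite setTI; apply/seteqP; split=> w; rewrite /bad /= gee0_abs// /g sumEFin lee_fin.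
split.
  rewrite badE; apply: emeasurable_fun_c_infty => //.
  exact: measurableT_comp.
have := @le_integral_abse _ _ _ P _ measurableT g lam mg lam0.
rewrite -badE (_ : (\int[P]_x `|g x|)%E = (\int[P]_x g x)%E); last first.
  by apply: eq_integral => w _; rewrite gee0_abs.
rewrite ge0_integral_sum//=.
move=> H; rewrite EFinM lee_pdivlMr// muleC; apply: (le_trans H) => {H}.
elim: I {bad g mg g0 badE} => [|n I IH]; first by rewrite !big_nil mul0r.
rewrite !big_cons -natr1 mulrDl mul1r [X in X%:E]addrC EFinD leeD//.
rewrite integral_indic// setIT; exact: PA.
Qed.

Lemma geometric_union_bound (R : realType) (d : measure_display)
    (Omega : measurableType d) (P : probability Omega R) (A : nat -> set Omega)
    (a rr : R) :
  (forall n, measurable (A n)) -> (forall n, (P (A n) <= (a * rr ^+ n)%:E)%E) ->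
  0 <= a -> 0 <= rr -> rr < 1 ->
  (P (\bigcup_n A n) <= (a / (1 - rr))%:E)%E.
Proof.
move=> mA PA a0 rr0 rr1.
apply: (@le_trans _ _ (\sum_(0 <= n <oo) P (A n))%E).
  by apply: measure_sigma_subadditive => //; exact: bigcupT_measurable.
apply: lime_le; first exact: is_cvg_nneseries.
near=> n.
apply: (@le_trans _ _ (\sum_(0 <= k < n) (a * rr ^+ k)%:E)%E).
  exact: lee_sum.
rewrite sumEFin lee_fin.
have rr_neq1 : rr != 1 by rewrite lt_eqF.
have /(congr1 (fun f => f n)) /= := geometric_seriesE a rr_neq1.
rewrite /series/= => ->.
apply: ler_wpM2r; first by rewrite invr_ge0 subr_ge0 ltW.
by rewrite mulrBr mulr1 gerBl mulr_ge0// exprn_ge0.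
Unshelve. all: by end_near. Qed.

(** * Pathwise bound on the mistakes *)

(** Mistakes inside the [r]-expansion are charged to the visits there; the others form a family [I]
    to which [far_size] applies. *)
Lemma mistakes_le (R : realType) (dT : measure_display) (T : measurableType dT)
    (rho : T -> T -> R) (dY : measure_display) (Y : measurableType dY)
    (eta : T -> Y) (dd : nat) (K M beta : R) (x xt : nat -> T) (N : nat) (r : R) :
  is_metric rho -> length_space rho -> (forall y z, rho y z <= M) ->
  (forall (y : T) (s : R), exists C : seq T, (size C <= 2 ^ dd)%N /\
      oball rho y s `<=` \bigcup_(c in [set c | c \in C]) oball rho c (s / 2)) ->
  0 <= K -> 1 <= beta ->
  (forall s, 0 < s -> s <= M -> exists2 C : seq T,
     (size C)%:R <= K * s `^ (- beta) &
     eta_boundary rho eta `<=`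
       \bigcup_(c in [set c | c \in C]) oball rho c s) ->
  (forall n i, (i < n)%N -> rho (x n) (xt n) <= rho (x n) (x i)) ->
  0 < r ->
  \sum_(1 <= n < N.+1) ((eta (x n) != eta (xt n)) : nat)%:R <=
    2 * (2 ^ dd * 2 ^ dd * 2 ^ dd)%:R * K * r `^ (- beta) +
    \sum_(1 <= n < N.+1) \1_(expansion rho (eta_boundary rho eta) r) (x n).
Proof.
move=> mrho len rhoM doub K0 beta1 covA nn r0.
have [_ _ rhoC _] := mrho.
set V := expansion _ _ _.
pose far n := (eta (x n) != eta (xt n)) && (x n \notin V).
pose I := [seq n <- index_iota 1 N.+1 | far n].
apply: (@le_trans _ _ ((size I)%:R + \sum_(1 <= n < N.+1) \1_V (x n))).
  rewrite /I size_filter -sum1_count natr_sum [X in _ <= X + _]big_mkcond -big_split/=.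
  apply: ler_sum => n _; rewrite /far indicE.
  by case: (x n \in V); case: (_ != _); rewrite /= ?addr0 ?add0r ?ler01.
rewrite lerD2r.
(* [far_size] needs a nonempty boundary, which any single mistake provides. *)
have [I0|[n nI]] : I = [::] \/ exists n, n \in I.
- by case: I => [|n I]; [left|right; exists n; rewrite mem_head].
- by rewrite I0 !mulr_ge0 ?powR_ge0.
apply: (far_size _ _ _ _ (eta_boundary rho eta) _ M _ x) => //; first exact: mrho.
- move: nI; rewrite mem_filter => /andP[/andP[/eqP neq _] _].
  by have [z Az _] := boundary_between _ _ _ _ _ _ _ _ _ _ mrho len neq (@ltr01 R); exists z.
- by rewrite filter_uniq// iota_uniq.
(* A boundary point lies within [rho (x j) (xt j) + e] of [x j], and no earlier [x i] is closer to
   [x j] than [xt j]; so the distance to the boundary bounds [rho (x j) (x i)] from below. *)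
- move=> i j _; rewrite mem_filter => /andP[/andP[/eqP neq _] _] ij s sA.
  apply: le_trans (nn _ _ ij); apply/ler_addgt0Pr => e e0.
  have [z /sA sz zr] := boundary_between _ _ _ _ _ _ _ _ _ _ mrho len neq e0.
  exact: le_trans sz (ltW zr).
- move=> i; rewrite mem_filter => /andP[/andP[_ /negP iV] _] z Az.
  rewrite leNgt; apply/negP => iz; apply: iV; rewrite inE.
  by exists z => //; rewrite /oball/= rhoC.
Qed.

(** * Visits of the process at dyadic times *)

Lemma smoothed_marginal (R : realType) (dT : measure_display)
    (T : measurableType dT) (nu : {measure set T -> \bar R})
    (dO : measure_display) (Omega : measurableType dO) (P : probability Omega R)
    (sigma : R) (X : nat -> Omega -> T) (n : nat) (A : set T) :
  smoothed P nu sigma X -> measurable A ->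
  (P (X n @^-1` A) <= (sigma^-1)%:E * nu A)%E.
Proof.
move=> smX mA; have := smX n A mA setT.
rewrite setIT probability_setT mule1; apply.
have [past0 pastC _] := smallest_sigma_algebra setT (past_gen X n).
by have := pastC _ past0; rewrite setD0.
Qed.

(* The extra exponent [c] makes the Markov bounds at the times [2 ^ k] summable,
   so first moments suffice and no independence is used. *)
Lemma dyadic_visits (R : realType) (dO : measure_display)
    (Omega : measurableType dO) (P : probability Omega R)
    (V : R -> nat -> set Omega) (K b c p : R) :
  (forall r n, measurable (V r n)) ->
  (forall r n, 0 < r -> (P (V r n) <= (K * r)%:E)%E) ->
  0 <= K -> 0 < b -> 0 < c -> 0 < p ->
  exists2 D, 0 < D & exists E : set Omega,
    [/\ measurable E, ((1 - p)%:E <= P E)%E &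
      forall w, E w -> forall k : nat, let u := (2 ^ k)%:R in
        \sum_(1 <= n < (2 ^ k).+1) \1_(V (u `^ (- (b + 1)^-1)) n) w <=
          D * u `^ ((b + c) / (b + 1))].
Proof.
move=> mV PV K0 b0 c0 p0.
(* With [u = 2 ^ k], the Markov bound is a multiple of [u * u ^ (- 1 / (b + 1)) / u ^ ((b + c) / (b
   + 1))], that is [u ^ (- c / (b + 1))], which equals [rr ^ k]. *)
pose rr : R := 2 `^ (- (c / (b + 1))).
have cb : 0 < c / (b + 1) by rewrite divr_gt0// addr_gt0.
have rr1 : rr < 1.
  rewrite /rr /powR gt_eqF// expR_lt1 nmulr_rlt0 ?oppr_lt0//.
  by rewrite ln_gt0// ltr1n.
have rr0 : 0 <= rr by exact: powR_ge0.
(* Chosen so that the geometric sum [(K / D) / (1 - rr)] is at most [p]; the 1 keeps [D]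
   positive. *)
pose D := K / (p * (1 - rr)) + 1.
have prr : 0 < p * (1 - rr) by rewrite mulr_gt0// subr_gt0.
have D0 : 0 < D by rewrite ltr_wpDl// divr_ge0// ltW.
exists D => //.
pose u k : R := (2 ^ k)%:R.
have u0 k : 0 < u k by rewrite ltr0n expn_gt0.
pose lam k := D * u k `^ ((b + c) / (b + 1)).
have lam0 k : 0 < lam k by rewrite mulr_gt0// powR_gt0.
pose r k := u k `^ (- (b + 1)^-1).
have r0 k : 0 < r k by rewrite powR_gt0.
pose bad k := [set w | lam k <= \sum_(1 <= n < (2 ^ k).+1) \1_(V (r k) n) w].
have bad_spec k : measurable (bad k) /\ (P (bad k) <= (K / D * rr ^+ k)%:E)%E.
  have [mbad Pbad] := @markov_count _ _ _ P (V (r k)) (index_iota 1 (2 ^ k).+1)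
    (K * r k) (lam k) (mV _) (fun n => PV _ n (r0 k)) (lam0 k).
  split=> //; apply: le_trans Pbad _.
  rewrite size_iota subn1 /= lee_fin -/(u k).
  have -> : rr ^+ k = u k * r k / u k `^ ((b + c) / (b + 1)).
    have -> : rr ^+ k = u k `^ (- (c / (b + 1))).
      rewrite -[LHS]powR_mulrn// /rr powRAC; congr (_ `^ _).
      by rewrite /u natrX powR_mulrn.
    rewrite -[X in X * r k / _](powRr1 (ltW (u0 k))) -powRN /r.
    rewrite -!powRD ?(gt_eqF (u0 k)) ?implybT//; congr (_ `^ _).
    by field; rewrite gt_eqF// addr_gt0.
  rewrite /lam le_eqVlt; apply/orP; left; apply/eqP.
  by field; rewrite !gt_eqF// powR_gt0.
have mbad k := (bad_spec k).1.
exists (~` \bigcup_k bad k); split.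
- by apply: measurableC; exact: bigcupT_measurable.
- rewrite probability_setC; last exact: bigcupT_measurable.
  rewrite EFinB leeB//.
  have /le_trans := geometric_union_bound _ _ _ P bad (K / D) rr mbad
    (fun k => (bad_spec k).2) (divr_ge0 K0 (ltW D0)) rr0 rr1.
  apply; rewrite lee_fin ler_pdivrMr ?subr_gt0// ler_pdivrMr//.
  by rewrite -ler_pdivrMl// mulrC /D lerDl.
- move=> w Ew k /=; rewrite leNgt; apply/negP => lt_k.
  by apply: Ew; exists k => //; rewrite /bad/= ltW.
Qed.

(** * Assembly of the bounds *)

Theorem theorem9 (R : realType) (dT : measure_display) (T : measurableType dT)
  (rho : T -> T -> R) (nu : {measure set T -> \bar R})
  (dY : measure_display) (Y : measurableType dY) (eta : T -> Y)
  (dO : measure_display) (Omega : measurableType dO) (P : probability Omega R)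
  (X : nat -> Omega -> T) (sigma b m : R) :
  is_metric rho -> metric_bounded rho -> length_space rho -> doubling rho ->
  borel_wrt rho -> (nu setT < +oo)%E ->
  in_F0 rho eta nu ->
  (forall n, measurable_fun setT (X n)) ->
  0 < sigma -> smoothed P nu sigma X ->
  box_dim rho (eta_boundary rho eta) = b%:E -> 1 < b ->
  minkowski_content rho nu (eta_boundary rho eta) = m%:E ->
  forall c1 c2 p : R, 0 < c1 -> 0 < c2 -> 0 < p ->
  exists C0 C1 : R, [/\ 0 < C0, 0 < C1 &
    forall Xt : nat -> Omega -> T, nn_process rho X Xt ->
      exists E : set Omega, [/\ measurable E, (P E >= (1 - p)%:E)%E &
        forall w, E w -> forall N : nat,
          \sum_(1 <= n < N.+1) ((eta (X n w) != eta (Xt n w)) : nat)%:R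
            <= C0 + C1 * (((m + c2) * N%:R / sigma) `^ ((b + c1) / (b + 1)))]].
Proof.
move=> mrho [M0 rhoM0] len [dd doub] borel nufin [_ nuA] mX sigma0 smX dimA b1.
move=> contA c1 c2 p c10 c20 p0.
set A := eta_boundary rho eta in nuA dimA contA *.
pose M := Num.max M0 1.
have M_gt0 : 0 < M by rewrite lt_max ltr01 orbT.
have rhoM y z : rho y z <= M by rewrite le_max rhoM0.
have b0 : 0 < b by exact: lt_trans b1.
have [K K0 covA] := box_dim_cover _ _ _ _ _ (b + c1) M dimA
  (ltr_pwDr c10 (lexx b)) (addr_gt0 b0 c10) M_gt0.
have [Kn Kn0 nuV] := minkowski_linear _ _ _ _ _ _ _ mrho borel nufin nuA contA.
have m0 : 0 <= m.
  by rewrite -lee_fin -contA; apply: minkowski_content_ge0.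
have mV r : measurable (expansion rho A r) by exact: measurable_expansion.
pose V r n := X n @^-1` expansion rho A r.
(* The event [E] is built from [X] alone, so it serves every nearest neighbor process. *)
have [|r n r0|||||D D0 [E [mE PE HE]]] :=
  @dyadic_visits _ _ _ P V (sigma^-1 * Kn) b c1 p => //.
- by move=> r n; rewrite -[V r n]setTI; exact: mX.
- apply: le_trans (smoothed_marginal _ _ _ _ _ _ _ _ _ _ _ smX (mV r)) _.
  by rewrite -mulrA EFinM lee_wpmul2l ?nuV// lee_fin invr_ge0 ltW.
- by rewrite mulr_ge0// invr_ge0 ltW.
pose alpha := (b + c1) / (b + 1).
pose B := 2 * (2 ^ dd * 2 ^ dd * 2 ^ dd)%:R * K + D.
have B0 : 0 < B by rewrite ltr_wpDl// !mulr_ge0// ltW.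
pose kappa := (m + c2) / sigma.
have kappa0 : 0 < kappa by rewrite divr_gt0// ltr_wpDl.
have alpha0 : 0 <= alpha by rewrite divr_ge0// ltW// addr_gt0.
(* The factor [(2 / kappa) ^ alpha] turns [(kappa * N) ^ alpha] into [(2 * N) ^ alpha], which
   dominates the bound at the next power of 2. *)
exists 1, (B * (2 / kappa) `^ alpha); split => //.
  by rewrite mulr_gt0// powR_gt0// divr_gt0.
move=> Xt nn; exists E; split => // w Ew N.
rewrite (_ : (m + c2) * N%:R / sigma = kappa * N%:R); last by rewrite /kappa mulrAC.
have kappa2 : 0 <= 2 / kappa by rewrite divr_ge0// ltW.
have kappaN : 0 <= kappa * N%:R by rewrite mulr_ge0// ltW.
rewrite -/alpha -mulrA -powRM//.
rewrite mulrA divfK ?gt_eqF//.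
have [->|N0] := posnP N.
  by rewrite big_geq// addr_ge0// mulr_ge0 ?powR_ge0// ltW.
apply: ler_wpDl => //.
(* The least [k] with [N < 2 ^ k], so that also [2 ^ k <= 2 * N]. *)
pose k := (trunc_log 2 N).+1.
have /andP[kN Nk] := trunc_log_bounds (isT : (1 < 2)%N) N0.
pose u : R := (2 ^ k)%:R.
have u0 : 0 < u by rewrite ltr0n expn_gt0.
have u2N : u <= 2 * N%:R by rewrite -natrM ler_nat /k expnS leq_mul2l.
apply: (@le_trans _ _ (B * u `^ alpha)); last first.
  apply: ler_wpM2l; first exact: ltW.
  by apply: ge0_ler_powR => //; rewrite nnegrE ?mulr_ge0// ltW.
pose r := u `^ (- (b + 1)^-1).
have r0 : 0 < r by rewrite powR_gt0.
have bc1 : 1 <= b + c1 by rewrite (le_trans (ltW b1))// lerDl ltW.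
have nnw n i : (i < n)%N -> rho (X n w) (Xt n w) <= rho (X n w) (X i w).
  by move=> ni; apply: (nn n w (leq_ltn_trans _ ni)).2.
apply: le_trans (mistakes_le _ _ _ _ _ _ eta _ _ _ _ (X ^~ w) (Xt ^~ w) N _
  mrho len rhoM doub (ltW K0) bc1 covA nnw r0) _.
rewrite /B [leRHS]mulrDl; apply: lerD.
  rewrite ler_wpM2l//; first by rewrite !mulr_ge0// ltW.
  (* The choice of [r] makes [r ^ (- (b + c1))] equal to [u ^ alpha], the order of the visit
     bound. *)
  by rewrite /r -powRrM /alpha mulrNN mulrC.
apply: le_trans (HE w Ew k).
(* Visits up to [N] are among those up to [2 ^ k], at the same radius. *)
rewrite [leRHS](@big_cat_nat _ _ _ N.+1)//=; last by rewrite ltnS ltnW.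
by rewrite lerDl sumr_ge0.
Qed.
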